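(* Let $k$ be a field and let $M,B,\mathcal{R}$ be $k$-algebras with $M^2=0$. Then $\mathcal{R}$ is an extension of $M$ by $B$ if and only if $M$ is a $B$-bimodule and there exists a factor set $\{(b,b')\mid b,b'\in B\}$ of $B$ in $M$ such that for any $b,b',b''\in B$, $$b(b',b'')-(bb',b'')+(b,b'b'')-(b,b')b''=0,$$ and $\mathcal{R}\cong A=E_k(M,B,(b_p,b_q))=k\langle (\{m_j\},\{b_i\})_+\mid S\rangle$, where $\{b_i\}_{i\in I}$ and $\{m_j\}_{j\in J}$ are any linear bases of $B$ and $M$ respectively, and $$S=\{\,b_pb_q=[b_pb_q]+(b_p,b_q),\ b_pm_j=[b_pm_j],\ m_jb_p=[m_jb_p],\ m_jm_l=0 \;\mid\; p,q\in I,\ j,l\in J\,\}.$$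
   Context: All algebras are associative over the field $k$ and need not have an identity. An algebra $\mathcal{R}$ is called an extension of $M$ by $B$ if $M^2=0$, $M$ is an ideal of $\mathcal{R}$ and $\mathcal{R}/M\cong B$ as algebras. A factor set $\{(b,b')\mid b,b'\in B\}$ of $B$ in $M$ is a subset of $M$, indexed by pairs of elements of $B$, such that the function $(b,b')$ is $k$-bilinear. The index sets $I$ and $J$ are linearly ordered. For a set $Y$, $k\langle Y_+\rangle$ is the free associative $k$-algebra without identity on $Y$ (the $k$-span of all nonempty words in $Y$), and $k\langle Y_+\mid S\rangle$ is its quotient by the ideal generated by $S$, where a relation $u=v$ is identified with the polynomial $u-v$; here $Y=\{m_j\}_{j\in J}\cup\{b_i\}_{i\in I}$. The notation $E_k(M,B,(b_p,b_q))$ is a name for the algebra $A$ so presented. $[b_pb_q]$ denotes the product of $b_p$ and $b_q$ in $B$, written as a linear combination of the $b_i$; $[b_pm_j]$ and $[m_jb_p]$ denote the results of the left and right actions of $B$ on $M$, written as linear combinations of the basis elements of $M$; $(b_p,b_q)\in M$ is likewise written as a linear combination of the basis elements of $M$. *)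

(* Defs.v *)
From HB Require Import structures.
From mathcomp Require Import all_boot all_order all_algebra.
From mathcomp Require Import generic_quotient ring_quotient sesquilinear.
From mathcomp Require Import finmap boolp.
From mathcomp Require Import monalg.

Set Implicit Arguments.
Unset Strict Implicit.
Unset Printing Implicit Defensive.

Import GRing.Theory.
Local Open Scope ring_scope.

Reserved Notation "x ** y" (at level 40, left associativity).

(* Associative algebras over a field, not assumed to have an identity. *)
HB.mixin Record Lmodule_isNuAlgebra (k : fieldType) A of GRing.Lmodule k A := {
  numul : A -> A -> A;
  numulA : associative numul;
  numul_bilinear : bilinear_for *:%R *:%R numul
}.

#[short(type="nualgType")]
HB.structure Definition NuAlgebra (k : fieldType) :=
  {A of GRing.Lmodule k A & Lmodule_isNuAlgebra k A}.

Notation "x ** y" := (numul x y) : ring_scope.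

HB.instance Definition _ (k : fieldType) (A : nualgType k) :=
  bilinear_isBilinear.Build k A A A *:%R *:%R (@numul k A) numul_bilinear.

Section NuAlgebraTheory.
Context (k : fieldType) (A : nualgType k).
Implicit Types x y z : A.

Lemma numulBl x y z : (x - y) ** z = x ** z - y ** z.
Proof. exact: linearBl. Qed.

Lemma numulBr x y z : z ** (x - y) = z ** x - z ** y.
Proof. exact: linearBr. Qed.

Lemma numulDl x y z : (x + y) ** z = x ** z + y ** z.
Proof. exact: linearDl. Qed.

Lemma numulDr x y z : z ** (x + y) = z ** x + z ** y.
Proof. exact: linearDr. Qed.

Lemma nuscalel a x y : (a *: x) ** y = a *: (x ** y).
Proof. by rewrite linearZl_LR. Qed.

Lemma nuscaler a x y : x ** (a *: y) = a *: (x ** y).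
Proof. by rewrite linearZr_LR. Qed.

End NuAlgebraTheory.

Definition nuhom (k : fieldType) (A B : nualgType k) (f : A -> B) : Prop :=
  linear f /\ {morph f : x y / x ** y >-> x ** y}.

Definition nuiso (k : fieldType) (A B : nualgType k) : Prop :=
  exists f : A -> B, nuhom f /\ bijective f.

(* Closure under opposite follows from closure under scaling by [-1]. *)
Record nuideal (k : fieldType) (A : nualgType k) := NuIdeal {
  nuideal_pred :> {pred A};
  nuideal_submod : GRing.subsemimod_closed nuideal_pred;
  nuidealMl : forall x y, y \in nuideal_pred -> x ** y \in nuideal_pred;
  nuidealMr : forall x y, x \in nuideal_pred -> x ** y \in nuideal_pred
}.

HB.instance Definition _ (k : fieldType) (A : nualgType k) (I : nuideal A) :=
  GRing.isSubmodClosed.Build k A (nuideal_pred I) (nuideal_submod I).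

(* The library's quotient of an abelian group by a subgroup, which receives
   the induced algebra structure below. *)
Notation nuquot I := (Quotient.quot (I : {pred _})).

Section NuQuotient.
Context (k : fieldType) (A : nualgType k) (I : nuideal A).
Local Open Scope quotient_scope.
Local Notation Q := (nuquot I).

Definition nuq_scale (a : k) : Q -> Q := lift_op1 Q ( *:%R a).
Definition nuq_mul : Q -> Q -> Q := lift_op2 Q (@numul k A).

Lemma pi_nuq_scale a : {morph \pi_Q : x / a *: x >-> nuq_scale a x}.
Proof.
move=> x; rewrite /nuq_scale; unlock; apply/eqP.
by rewrite -Quotient.idealrBE -scalerBr rpredZ // Quotient.idealrBE reprK.
Qed.

Lemma pi_nuq_mul : {morph \pi_Q : x y / x ** y >-> nuq_mul x y}.
Proof.
move=> x y; rewrite /nuq_mul; unlock; apply/eqP; rewrite -Quotient.idealrBE.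
rewrite -[_ ** _](addrNK (x ** repr (\pi_Q y))) -numulBr -addrA -numulBl.
rewrite rpredD //.
  by rewrite nuidealMl // Quotient.idealrBE reprK.
by rewrite nuidealMr // Quotient.idealrBE reprK.
Qed.

Lemma nuq_scaleA a b (x : Q) :
  nuq_scale a (nuq_scale b x) = nuq_scale (a * b) x.
Proof. by rewrite -[x]reprK -!pi_nuq_scale scalerA. Qed.

Lemma nuq_scale1 : left_id 1 nuq_scale.
Proof. by move=> x; rewrite -[x]reprK -pi_nuq_scale scale1r. Qed.

Lemma nuq_scaleDr : right_distributive nuq_scale +%R.
Proof.
move=> a x y; rewrite -[x]reprK -[y]reprK.
by rewrite -(raddfD (\pi_Q)) -!pi_nuq_scale -(raddfD (\pi_Q)) scalerDr.
Qed.

Lemma nuq_scaleDl (x : Q) : {morph nuq_scale^~ x : a b / a + b}.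
Proof.
by move=> a b; rewrite -[x]reprK -!pi_nuq_scale -(raddfD (\pi_Q)) scalerDl.
Qed.

HB.instance Definition _ := GRing.Zmodule_isLmodule.Build k (nuquot I)
  nuq_scaleA nuq_scale1 nuq_scaleDr nuq_scaleDl.

Lemma nuq_mulA : associative nuq_mul.
Proof.
by move=> x y z; rewrite -[x]reprK -[y]reprK -[z]reprK -!pi_nuq_mul numulA.
Qed.

Lemma pi_nuq_linear a (x y : A) :
  \pi_Q (a *: x + y) = a *: \pi_Q x + \pi_Q y.
Proof. by rewrite raddfD /= pi_nuq_scale. Qed.

Lemma nuq_mul_bilinear : bilinear_for *:%R *:%R nuq_mul.
Proof.
split=> z a x y; rewrite -[x]reprK -[y]reprK -[z]reprK.
  rewrite /= -pi_nuq_linear -!pi_nuq_mul -pi_nuq_linear.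
  by rewrite numulDl nuscalel.
by rewrite /= -pi_nuq_linear -!pi_nuq_mul -pi_nuq_linear numulDr nuscaler.
Qed.

HB.instance Definition _ := Lmodule_isNuAlgebra.Build k (nuquot I)
  nuq_mulA nuq_mul_bilinear.

End NuQuotient.

Section GeneratedIdeal.
Context (k : fieldType) (A : nualgType k) (S : A -> Prop).

Definition ideal_gen : {pred A} := fun x =>
  `[< forall I : nuideal A, (forall s, S s -> s \in I) -> x \in I >].

Lemma ideal_genP x : reflect
  (forall I : nuideal A, (forall s, S s -> s \in I) -> x \in I)
  (x \in ideal_gen).
Proof. exact: asboolP. Qed.

Lemma ideal_gen_submod : GRing.subsemimod_closed ideal_gen.
Proof.
split; [split=> [|x y] | move=> a x].
- by apply/ideal_genP=> I hI; rewrite rpred0.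
- move=> /ideal_genP hx /ideal_genP hy; apply/ideal_genP=> I hI.
  by rewrite rpredD ?hx ?hy.
- by move=> /ideal_genP hx; apply/ideal_genP=> I hI; rewrite rpredZ ?hx.
Qed.

Lemma ideal_genMl x y : y \in ideal_gen -> x ** y \in ideal_gen.
Proof. by move=> /ideal_genP hy; apply/ideal_genP=> I hI; rewrite nuidealMl ?hy. Qed.

Lemma ideal_genMr x y : x \in ideal_gen -> x ** y \in ideal_gen.
Proof. by move=> /ideal_genP hx; apply/ideal_genP=> I hI; rewrite nuidealMr ?hx. Qed.

Definition nuideal_gen : nuideal A :=
  NuIdeal ideal_gen_submod ideal_genMl ideal_genMr.

End GeneratedIdeal.

(* The free algebra without identity on [Y]: [{malg k[{fmonom Y}]}] is the free
   unital algebra, with the words in [Y] as a basis, and the span of the nonempty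
   words consists of the elements whose coefficient at the empty word is 0. *)
Section FreeNuAlgebra.
Context (k : fieldType) (Y : choiceType).
Local Notation F := {malg k[{fmonom Y}]}.

Definition no_empty_word : {pred F} := fun x => x@_(mone : {fmonom Y}) == 0.

Lemma no_empty_wordE x : (x \in no_empty_word) = (x@_(mone : {fmonom Y}) == 0).
Proof. by []. Qed.

Lemma no_empty_word_submod : GRing.subsemimod_closed no_empty_word.
Proof.
split; [split=> [|x y] | move=> a x].
- by rewrite no_empty_wordE mcoeff0.
- by rewrite !no_empty_wordE mcoeffD => /eqP-> /eqP->; rewrite addr0.
- by rewrite !no_empty_wordE mcoeffZ => /eqP->; rewrite mulr0.
Qed.

HB.instance Definition _ := GRing.isSubmodClosed.Build k F no_empty_word
  no_empty_word_submod.

Record freenu : predArgType :=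
  FreeNu { freenu_val : F; freenuP : freenu_val \in no_empty_word }.

HB.instance Definition _ := [isSub for freenu_val].
HB.instance Definition _ := [Choice of freenu by <:].
HB.instance Definition _ := [SubChoice_isSubLmodule of freenu by <:].

Lemma freenu_mul_subproof (x y : freenu) :
  freenu_val x * freenu_val y \in no_empty_word.
Proof.
have /eqP hx : freenu_val x \in no_empty_word := freenuP x.
rewrite no_empty_wordE mcoeffMl big1 // => k1 _; rewrite big1 // => k2 _.
by case: (eqVneq (mmul k1 k2)) => // /unitm[-> _]; rewrite hx mul0r.
Qed.

Definition freenu_mul (x y : freenu) : freenu :=
  FreeNu (freenu_mul_subproof x y).

Lemma freenu_mulA : associative freenu_mul.
Proof. by move=> x y z; apply: val_inj; rewrite /= mulrA. Qed.

Lemma malg_scaler (a : k) (x y : F) : x * (a *: y) = a *: (x * y).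
Proof.
rewrite (malgMEw (fsubset_refl _) (msuppZ_le a y)) malgME scaler_sumr.
apply: eq_bigr => k1 _; rewrite scaler_sumr; apply: eq_bigr => k2 _.
by apply/malgP => w; rewrite !(mcoeffZ, mcoeffU) mulrnAr mulrCA.
Qed.

Lemma freenu_mul_bilinear : bilinear_for *:%R *:%R freenu_mul.
Proof.
split=> z a x y; apply: val_inj.
  by rewrite /= mulrDl scalerAl.
by rewrite /= mulrDr malg_scaler.
Qed.

HB.instance Definition _ := Lmodule_isNuAlgebra.Build k freenu
  freenu_mulA freenu_mul_bilinear.

Lemma freenu_gen_subproof (y : Y) : << fmu y >> \in no_empty_word.
Proof. by rewrite no_empty_wordE mcoeffU1 fm1_eq1. Qed.

Definition freenu_gen (y : Y) : freenu := FreeNu (freenu_gen_subproof y).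

End FreeNuAlgebra.

Definition presented (k : fieldType) (Y : choiceType) (S : freenu k Y -> Prop) :
  nualgType k := nuquot (nuideal_gen S).

Section LinearBasis.
Context (k : fieldType) (V : lmodType k) (I : choiceType).

Definition lincomb (W : lmodType k) (v : I -> W) (c : {malg k[I]}) : W :=
  \sum_(i <- msupp c) c@_i *: v i.

Record linbasis := LinBasis {
  linbasis_vec :> I -> V;
  linbasis_free : forall c : {malg k[I]}, lincomb linbasis_vec c = 0 -> c = 0;
  linbasis_span : forall x : V, exists c : {malg k[I]}, lincomb linbasis_vec c = x
}.

Definition coord (b : linbasis) (x : V) : {malg k[I]} :=
  projT1 (cid (linbasis_span b x)).

Lemma lincomb_coord (b : linbasis) x : lincomb b (coord b x) = x.
Proof. exact: projT2 (cid (linbasis_span b x)). Qed.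

End LinearBasis.

(* No unit axiom, since [B] need not have an identity. *)
Record bimodule (k : fieldType) (B : nualgType k) (M : lmodType k) := Bimodule {
  lact : {bilinear B -> M -> M};
  ract : {bilinear M -> B -> M};
  lactA : forall b b' m, lact (b ** b') m = lact b (lact b' m);
  ractA : forall m b b', ract m (b ** b') = ract (ract m b) b';
  lractA : forall b m b', ract (lact b m) b' = lact b (ract m b')
}.

(* [M] need not be a subset of [R]: it is identified with an ideal of [R] through
   an injective homomorphism. *)
Definition extension (k : fieldType) (M B R : nualgType k) : Prop :=
  (forall x y : M, x ** y = 0) /\
  exists2 i : M -> R, nuhom i /\ injective i &
  exists2 I : nuideal R, (forall r, r \in I <-> exists m, i m = r) &
  nuiso (nuquot I) B.

Definition cocycle (k : fieldType) (M B : nualgType k) (act : bimodule B M)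
    (f : {bilinear B -> B -> M}) : Prop :=
  forall b b' b'' : B,
    lact act b (f b' b'') - f (b ** b') b'' + f b (b' ** b'')
      - ract act (f b b') b'' = 0.

Section Presentation.
Context (k : fieldType) (M B : nualgType k) (I J : choiceType).
Context (act : bimodule B M) (f : {bilinear B -> B -> M}).
Context (b : linbasis B I) (m : linbasis M J).
Local Notation F := (freenu k (J + I)%type).

(* [inl j] is the letter [m_j] and [inr i] the letter [b_i]. *)
Definition genM (j : J) : F := freenu_gen k (inl j).
Definition genB (i : I) : F := freenu_gen k (inr i).

(* An element of [M] or [B], rewritten as the corresponding linear combination
   of letters. *)
Definition wordM (x : M) : F := lincomb genM (coord m x).
Definition wordB (x : B) : F := lincomb genB (coord b x).

(* An equation [u = v] is encoded as the polynomial [u - v]. *)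
Inductive relator : F -> Prop :=
| relator_bb p q : relator
    (genB p ** genB q - (wordB (b p ** b q) + wordM (f (b p) (b q))))
| relator_bm p j : relator (genB p ** genM j - wordM (lact act (b p) (m j)))
| relator_mb j p : relator (genM j ** genB p - wordM (ract act (m j) (b p)))
| relator_mm j l : relator (genM j ** genM l).

Definition Ealg : nualgType k := presented relator.

End Presentation.

(* Main.v *)
(* Given a cocycle f, the space M x B with the product
     (x, y) (x', y') = (y x' + x y' + f (y, y'), y y')
   is an algebra, an extension of M by B. A linear section s of R -> B
   identifies an arbitrary extension R with such a product, the cocycle being
   f (y, y') = s y s y' - s (y y'). Sending the letters m_j and b_i to their
   values gives a surjection of the free algebra onto the product. In the
   presented algebra the relations, which hold between letters, extend
   bilinearly to all of M and B, so that (x, y) |-> x + y is a homomorphism from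
   the product to the presented algebra; composed with the surjection it is the
   quotient map, since both agree on letters. Hence the kernel of the surjection
   is the ideal of relations. *)
From HB Require Import structures.
From mathcomp Require Import all_boot all_order all_algebra.
From mathcomp Require Import sesquilinear generic_quotient ring_quotient.
From mathcomp Require Import finmap boolp classical_sets.
From mathcomp Require Import monalg.
Require Import Defs.

Set Implicit Arguments.
Unset Strict Implicit.
Unset Printing Implicit Defensive.

Import GRing.Theory.
Local Open Scope ring_scope.

(** * Formal linear combinations with finitely supported coefficients *)

Section LinearCombinations.
Context (k : fieldType) (I : choiceType) (W : lmodType k).
Implicit Types (v : I -> W) (c : {malg k[I]}).

Lemma lincombEw v (d : {fset I}) c : (msupp c `<=` d)%fset ->
  lincomb v c = \sum_(i <- d) c@_i *: v i.
Proof.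
move=> le_cd; apply: big_fset_incl => // i _ /mcoeff_outdom ->.
by rewrite scale0r.
Qed.

Lemma lincomb_is_linear v : linear (lincomb v).
Proof.
move=> a c c'; pose d := (msupp c `|` msupp c')%fset.
have le_d : (msupp (a *: c + c') `<=` d)%fset.
  apply: fsubset_trans (msuppD_le _ _) _.
  by rewrite fsetUSS ?msuppZ_le.
rewrite (lincombEw v le_d) (@lincombEw v d c) ?fsubsetUl //.
rewrite (@lincombEw v d c') ?fsubsetUr // scaler_sumr -big_split /=.
by apply: eq_bigr => i _; rewrite mcoeffD mcoeffZ scalerDl scalerA.
Qed.

HB.instance Definition _ v :=
  GRing.isLinear.Build k {malg k[I]} W *:%R (lincomb v) (lincomb_is_linear v).

Lemma lincombU v i : lincomb v << i >> = v i.
Proof.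
rewrite (@lincombEw v [fset i]%fset) ?msuppU_le //.
by rewrite big_seq_fset1 mcoeffUU scale1r.
Qed.

Lemma linear_lincomb (W' : lmodType k) (g : {linear W -> W'}) v c :
  g (lincomb v c) = lincomb (g \o v) c.
Proof. by rewrite linear_sum; apply: eq_bigr => i _; rewrite linearZ. Qed.

Lemma malgUZ (a : k) i : << a *g i >> = a *: << i >> :> {malg k[I]}.
Proof. by apply/malgP => j; rewrite mcoeffZ !mcoeffU mulr_natr. Qed.

Lemma lincomb_malgU c : lincomb (fun i => << i >>) c = c.
Proof. by rewrite [RHS]monalgE; apply: eq_bigr => i _; rewrite malgUZ. Qed.

End LinearCombinations.

(** * Coordinates, and linear maps determined on a basis *)

Section Bases.
Context (k : fieldType) (V : lmodType k) (I : choiceType) (b : linbasis V I).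

Lemma coord_is_linear : linear (coord b).
Proof.
move=> a x y; apply/eqP; rewrite -subr_eq0; apply/eqP.
apply: (linbasis_free (l := b)).
by rewrite linearB linearP /= !lincomb_coord subrr.
Qed.

HB.instance Definition _ :=
  GRing.isLinear.Build k V {malg k[I]} *:%R (coord b) coord_is_linear.

Lemma coord_basis i : coord b (b i) = << i >>.
Proof.
apply/eqP; rewrite -subr_eq0; apply/eqP; apply: (linbasis_free (l := b)).
by rewrite linearB /= lincomb_coord lincombU subrr.
Qed.

(** The maps are unbundled so that the lemma applies directly to partial applications of a product
    or of a bilinear map. *)
Lemma linbasis_ext (W : lmodType k) (g h : V -> W) :
  linear g -> linear h -> (forall i, g (b i) = h (b i)) -> g =1 h.
Proof.
move=> g_lin h_lin gh x.
pose G : {linear V -> W} :=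
  HB.pack_for {linear V -> W} g (GRing.isLinear.Build k V W *:%R g g_lin).
pose H : {linear V -> W} :=
  HB.pack_for {linear V -> W} h (GRing.isLinear.Build k V W *:%R h h_lin).
rewrite -[LHS]/(G x) -[RHS]/(H x) -(lincomb_coord b x) !linear_lincomb.
by apply: eq_bigr => i _; rewrite /= gh.
Qed.

End Bases.

(** This carries a relation between letters over to all vectors: [linbasis_ext] is used once in each
    argument. *)
Lemma linbasis_mul_ext (k : fieldType) (V V' : lmodType k) (A : nualgType k)
    (I I' : choiceType) (b : linbasis V I) (b' : linbasis V' I')
    (u : {linear V -> A}) (u' : {linear V' -> A}) (c : V -> V' -> A) :
  (forall y, linear (c^~ y)) -> (forall x, linear (c x)) ->
  (forall i i', u (b i) ** u' (b' i') = c (b i) (b' i')) ->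
  forall x y, u x ** u' y = c x y.
Proof.
move=> cl cr ucb x; apply: (linbasis_ext (b := b')) => [a y y'|//|i'].
  by rewrite linearP numulDr nuscaler.
move: x; apply: (linbasis_ext (b := b)) => [a x x'|//|//].
by rewrite linearP numulDl nuscalel.
Qed.

(** * Splitting a linear surjection by Zorn's lemma *)

Section LinearSection.
Context (k : fieldType) (U V : lmodType k) (p : {linear U -> V}).
Local Open Scope classical_set_scope.

(** Subspaces meeting the kernel of [p] trivially, except that [D 0] is not demanded: the union of
    the empty chain must also qualify. *)
Let independent (D : set U) :=
  (forall a x y, D x -> D y -> D (a *: x + y)) /\
  (forall x, D x -> p x = 0 -> x = 0).

(** A maximal independent [D] works: if [p x] were missed by the image of [D], the line through [x]
    could be adjoined. *)
Lemma exists_kernel_complement : exists2 D : set U, independent D &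
  forall x, exists2 d, D d & p d = p x.
Proof.
have [F FP Ftot|D [[DP Dp] Dmax]] := @Zorn_bigcup U independent.
  split=> [a x y [X FX Xx] [Y FY Yy]|x [X FX Xx]]; last exact: (FP X FX).2.
  have [XY|YX] := Ftot X Y FX FY.
    by exists Y => //; apply: (FP Y FY).1 => //; exact: XY.
  by exists X => //; apply: (FP X FX).1 => //; exact: YX.
(* Any element [x] of [D] gives [- x + x = 0] in [D], so without 0 the set [D] is empty and the zero
   subspace is strictly larger. *)
have D0 : D 0.
  apply: contrapT => nD0; apply: (Dmax [set 0]); last first.
    by split=> [a x y -> ->|x ->] //=; rewrite scaler0 addr0.
  have nD x : ~ D x.
    by move=> Dx; apply: nD0; rewrite -(addNr x) -scaleN1r; exact: DP.
  by split=> [x /nD|sub]; [|exact: (nD 0 (sub 0 erefl))].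
exists D => // x; apply: contrapT => nx.
pose D' : set U := [set y | exists a d, D d /\ y = a *: x + d].
have DD' : D `<` D'.
  split=> [d Dd|D'D]; first by exists 0, d; rewrite scale0r add0r.
  by apply: nx; exists x => //; apply: D'D; exists 1, 0; rewrite scale1r addr0.
apply: (Dmax D' DD'); split=> [c _ _ [a [d [Dd ->]]] [a' [d' [Dd' ->]]]|].
  exists (c * a + a'), (c *: d + d'); split; first exact: DP.
  by rewrite scalerDr scalerA scalerDl addrACA.
move=> _ [a [d [Dd ->]]]; rewrite linearP => pd.
have [a0|a0] := eqVneq a 0.
  by move: pd; rewrite a0 !scale0r !add0r; exact: Dp.
(* Solving [a *: p x + p d = 0] for [p x] gives this witness; the summand 0 puts it in the form of
   the closure property [DP]. *)
case: nx; exists (- a^-1 *: d + 0); first exact: DP.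
rewrite addr0 linearZ /= -(addKr (a *: p x) (p d)) pd addr0.
by rewrite scalerN scaleNr opprK scalerA mulVf // scale1r.
Qed.

(** Preimages are chosen in [D], where they are unique because [D] meets the kernel trivially;
    uniqueness makes the choice linear. *)
Lemma linear_section : (forall y, exists x, p x = y) ->
  exists s : {linear V -> U}, cancel s p.
Proof.
have [D [DP Dp] Dsurj] := exists_kernel_complement => psurj.
have /choice[s sP] y : exists d, D d /\ p d = y.
  by have [x <-] := psurj y; have [d] := Dsurj x; exists d.
have s_lin : linear s.
  move=> a x y; apply/eqP.
  rewrite eq_sym -subr_eq0 (addrC _ (- _)) -scaleN1r; apply/eqP.
  apply: Dp; first by apply: (DP); [|apply: DP]; exact: (sP _).1.
  by rewrite !linearP !(sP _).2 scaleN1r addNr.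
exists (HB.pack_for {linear V -> U} s
  (GRing.isLinear.Build k V U *:%R s s_lin)).
by move=> y; exact: (sP y).2.
Qed.

End LinearSection.

(** * Universal property of the free algebra without identity *)

Section FreeAlgebra.
Context (k : fieldType) (Y : choiceType).

Section Evaluation.
Context (A : nualgType k) (v : Y -> A).

(* The value 0 at the empty word is junk: elements of [freenu] do not involve
   that word. *)
Definition word_eval (w : {fmonom Y}) : A :=
  if fmonom_val w is y :: s then foldl (fun a z => a ** v z) (v y) s else 0.

(** The empty word is excluded because its junk value 0 is not neutral for the product. As [foldl]
    brackets to the left, the induction removes letters from the right end. *)
Lemma word_evalM w w' : w != mone -> w' != mone ->
  word_eval (mmul w w') = word_eval w ** word_eval w'.
Proof.
rewrite /word_eval !fmP fm1 fmM.
case: (fmonom_val w) (fmonom_val w') => [|y s] [|z t] //= _ _.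
rewrite foldl_cat /=; elim/last_ind: t => //= t x IHt.
by rewrite -!cats1 !foldl_cat /= IHt numulA.
Qed.

Definition free_eval (x : freenu k Y) : A := lincomb word_eval (freenu_val x).

Lemma free_eval_is_linear : linear free_eval.
Proof. by move=> a x y; rewrite /free_eval !linearP. Qed.

HB.instance Definition _ := GRing.isLinear.Build k (freenu k Y) A *:%R free_eval
  free_eval_is_linear.

Lemma free_eval_gen y : free_eval (freenu_gen k y) = v y.
Proof. by rewrite /free_eval lincombU /word_eval fmU. Qed.

Lemma free_evalM : {morph free_eval : x y / x ** y >-> x ** y}.
Proof.
move=> x y; rewrite /free_eval /=.
(* No empty word occurs in the support, so [word_evalM] covers every pair of words in the double
   sum. *)
have nemp (z : freenu k Y) w : w \in msupp (freenu_val z) -> w != mone.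
  by apply: contraTneq => ->; rewrite -mcoeff_eq0 -no_empty_wordE freenuP.
rewrite malgME linear_sum [in RHS]/lincomb linear_sumlz /= big_seq [RHS]big_seq.
apply: eq_bigr => w /nemp nw; rewrite linear_sum linear_sumr /=.
rewrite big_seq [RHS]big_seq; apply: eq_bigr => w' /nemp nw'.
by rewrite malgUZ linearZ /= lincombU word_evalM // nuscalel nuscaler scalerA.
Qed.

End Evaluation.

(** A nonempty word is the product of its letters; hence the letters generate the algebra. *)
Lemma free_eval_id x : free_eval (@freenu_gen k Y) x = x.
Proof.
apply: val_inj; rewrite /free_eval linear_lincomb -[RHS]lincomb_malgU.
rewrite /lincomb !big_seq; apply: eq_bigr => w w_x; congr (_ *: _).
have: w != mone.
  by apply: contraTneq w_x => ->; rewrite -mcoeff_eq0 -no_empty_wordE freenuP.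
rewrite fmP fm1 /= /word_eval -[w in RHS]fmK.
case: (fmonom_val w) => //= y s _.
elim/last_ind: s => [|s z IHs] /=; first by rewrite fmuE.
rewrite -cats1 foldl_cat /= IHs; apply/malgP => u.
rewrite malgME !msuppU1 !big_seq_fset1 !mcoeffUU mulr1 mcoeffU1 mcoeffU1.
by rewrite /mmul /= fmmulE fmuE.
Qed.

Lemma nuhom_free_eval (A A' : nualgType k) (g : {linear A -> A'}) (v : Y -> A) :
  {morph g : x y / x ** y >-> x ** y} ->
  g \o free_eval v =1 free_eval (g \o v).
Proof.
move=> gM x; rewrite /= /free_eval linear_lincomb; apply: eq_bigr => w _.
congr (_ *: _); rewrite /word_eval /=; case: (fmonom_val w) => [|y s] /=.
  exact: linear0.
by elim/last_ind: s => //= s z IHs; rewrite -!cats1 !foldl_cat /= gM IHs.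
Qed.

(** Writing [x] as its own evaluation at the letters turns both maps into evaluation at the same
    values. *)
Lemma freenu_hom_ext (A : nualgType k) (g h : {linear freenu k Y -> A}) :
  {morph g : x y / x ** y >-> x ** y} -> {morph h : x y / x ** y >-> x ** y} ->
  (forall y, g (freenu_gen k y) = h (freenu_gen k y)) -> g =1 h.
Proof.
move=> gM hM gh x; rewrite -(free_eval_id x).
rewrite -[LHS]/((g \o _) x) -[RHS]/((h \o _) x) !nuhom_free_eval //.
rewrite /free_eval; congr lincomb; congr word_eval.
by apply: funext => y /=.
Qed.

End FreeAlgebra.

(** * Isomorphisms, kernels and quotient projections *)

Section Isomorphisms.
Context (k : fieldType).
Implicit Types A B C : nualgType k.

Lemma nuiso_sym A B : nuiso A B -> nuiso B A.
Proof.
move=> [g [[glin gM] [h gK hK]]]; exists h; split; last by exists g.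
split=> [a x y|x y]; apply: (can_inj gK); rewrite hK.
  by rewrite glin !hK.
by rewrite gM !hK.
Qed.

Lemma nuiso_trans A B C : nuiso A B -> nuiso B C -> nuiso A C.
Proof.
move=> [g [[glin gM] gbij]] [h [[hlin hM] hbij]]; exists (h \o g); split.
  by split=> [a x y|x y] /=; rewrite ?glin ?hlin ?gM ?hM.
exact: bij_comp.
Qed.

End Isomorphisms.

Section Kernel.
Context (k : fieldType) (A A' : nualgType k) (g : {linear A -> A'}).
Hypothesis gM : {morph g : x y / x ** y >-> x ** y}.

Let ker : {pred A} := fun x => g x == 0.

Let kerE x : (x \in ker) = (g x == 0).
Proof. by []. Qed.

Lemma ker_submod : GRing.subsemimod_closed ker.
Proof.
split; [split=> [|x y] | move=> a x].
- by rewrite kerE linear0.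
- by rewrite !kerE linearD => /eqP-> /eqP->; rewrite addr0.
- by rewrite !kerE linearZ /= => /eqP->; rewrite scaler0.
Qed.

Lemma kerMl x y : y \in ker -> x ** y \in ker.
Proof. by rewrite !kerE gM => /eqP->; rewrite linear0r. Qed.

Lemma kerMr x y : x \in ker -> x ** y \in ker.
Proof. by rewrite !kerE gM => /eqP->; rewrite linear0l. Qed.

Definition nuker : nuideal A := NuIdeal ker_submod kerMl kerMr.

Lemma nukerE x : (x \in nuker) = (g x == 0).
Proof. by []. Qed.

(** The kernel is one of the ideals intersected in [nuideal_gen S]. *)
Lemma ideal_gen_sub_ker (S : A -> Prop) x :
  (forall s, S s -> g s = 0) -> x \in nuideal_gen S -> g x = 0.
Proof.
move=> gS /ideal_genP/(_ nuker) xker; apply/eqP; rewrite -nukerE.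
by apply: xker => s /gS gs; rewrite nukerE gs.
Qed.

End Kernel.

Section Projection.
Context (k : fieldType) (A : nualgType k) (I : nuideal A).
Local Open Scope quotient_scope.

Definition nuproj (x : A) : nuquot I := \pi_(nuquot I) x.

Lemma nuproj_is_linear : linear nuproj.
Proof. exact: pi_nuq_linear. Qed.

HB.instance Definition _ :=
  GRing.isLinear.Build k A (nuquot I) *:%R nuproj nuproj_is_linear.

Lemma nuprojM : {morph nuproj : x y / x ** y >-> x ** y}.
Proof. exact: pi_nuq_mul. Qed.

Lemma nuproj_eq x y : nuproj x = nuproj y <-> x - y \in I.
Proof.
by split=> [/eqP|xy]; [|apply/eqP]; rewrite -?Quotient.idealrBE.
Qed.

Lemma nuproj_surj q : nuproj (repr q) = q.
Proof. exact: reprK. Qed.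

End Projection.

(** The map built is the one from [A'] to the quotient, taking the class of a chosen preimage. It
    respects the operations because two preimages of one element differ by an element of [I]. *)
Lemma first_isomorphism (k : fieldType) (A A' : nualgType k)
    (g : {linear A -> A'}) (I : nuideal A) :
  {morph g : x y / x ** y >-> x ** y} -> (forall y, exists x, g x = y) ->
  (forall x, x \in I <-> g x = 0) -> nuiso (nuquot I) A'.
Proof.
move=> gM /choice[h hK] gI; apply: nuiso_sym; exists (fun y => nuproj I (h y)).
split; first split.
- move=> a x y; rewrite -linearP; apply/nuproj_eq/gI.
  by rewrite linearB linearP !hK subrr.
- move=> x y; rewrite -nuprojM; apply/nuproj_eq/gI.
  by rewrite linearB gM !hK subrr.
exists (fun q => g (repr q)) => [y|q].
  apply/eqP; rewrite -subr_eq0 -[y in _ - y]hK -linearB; apply/eqP/gI.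
  by apply/nuproj_eq; rewrite nuproj_surj.
rewrite -[RHS]nuproj_surj; apply/nuproj_eq/gI.
by rewrite linearB hK subrr.
Qed.

(** * Presenting an algebra [T] that is the direct sum of [i M] and [s B] *)

Section PresentationOfExtension.
Context (k : fieldType) (M B T : nualgType k) (I J : choiceType).
Context (act : bimodule B M) (f : {bilinear B -> B -> M}).
Context (b : linbasis B I) (m : linbasis M J).
Context (i : {linear M -> T}) (s : {linear B -> T}).
Context (j : {linear T -> M}) (p : {linear T -> B}).
Hypothesis (iK : forall x, j (i x) = x /\ p (i x) = 0).
Hypothesis (sK : forall y, j (s y) = 0 /\ p (s y) = y).
Hypothesis (jpK : forall t, i (j t) + s (p t) = t).
Hypothesis (mul_ss : forall y y', s y ** s y' = s (y ** y') + i (f y y')).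
Hypothesis (mul_si : forall y x, s y ** i x = i (lact act y x)).
Hypothesis (mul_is : forall x y, i x ** s y = i (ract act x y)).
Hypothesis (mul_ii : forall x x', i x ** i x' = 0).

Let letter_val (a : J + I) : T :=
  match a with inl j' => i (m j') | inr i' => s (b i') end.

Let F := freenu k (J + I)%type.
Local Notation ev := (free_eval letter_val : F -> T).

HB.instance Definition _ := GRing.Linear.copy (wordM I m)
  (lincomb (@genM k I J) \o coord m).
HB.instance Definition _ := GRing.Linear.copy (wordB J b)
  (lincomb (@genB k I J) \o coord b).

Lemma ev_wordM x : ev (wordM I m x) = i x.
Proof.
rewrite /wordM linear_lincomb -[in RHS](lincomb_coord m x) linear_lincomb.
by apply: eq_bigr => j' _; rewrite /= free_eval_gen.
Qed.

Lemma ev_wordB y : ev (wordB J b y) = s y.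
Proof.
rewrite /wordB linear_lincomb -[in RHS](lincomb_coord b y) linear_lincomb.
by apply: eq_bigr => i' _; rewrite /= free_eval_gen.
Qed.

Lemma wordM_basis j' : wordM I m (m j') = genM k I j'.
Proof. by rewrite /wordM coord_basis lincombU. Qed.

Lemma wordB_basis i' : wordB J b (b i') = genB k J i'.
Proof. by rewrite /wordB coord_basis lincombU. Qed.

(** * Homomorphisms that kill the relators factor through [ev] *)

Section KillRelators.
Context (Q : nualgType k) (g : {linear F -> Q}).
Hypothesis gM : {morph g : x y / x ** y >-> x ** y}.
Hypothesis g_relator : forall r, relator act f b m r -> g r = 0.

Let uB : {linear B -> Q} := g \o wordB J b.
Let uM : {linear M -> Q} := g \o wordM I m.

(** On basis vectors this is the image of a relator under [g], and both sides are bilinear. The next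
    three facts are obtained in the same way. *)
Let proj_bb y y' : uB y ** uB y' = uB (y ** y') + uM (f y y').
Proof.
apply: (linbasis_mul_ext (b := b) (b' := b)
  (c := fun y y' => uB (y ** y') + uM (f y y'))).
- move=> z a u v.
  rewrite numulDl nuscalel (linearPl f) (linearP uB) (linearP uM).
  by rewrite scalerDr addrACA.
- move=> z a u v.
  rewrite numulDr nuscaler (linearPr f) (linearP uB) (linearP uM).
  by rewrite scalerDr addrACA.
move=> i1 i2; apply/subr0_eq.
rewrite /uB /uM /= !wordB_basis -gM -linearD -linearB.
exact/g_relator/relator_bb.
Qed.

Let proj_bm y x : uB y ** uM x = uM (lact act y x).
Proof.
apply: (linbasis_mul_ext (b := b) (b' := m)
  (c := fun y x => uM (lact act y x))).
- by move=> z a u v; rewrite (linearPl (lact act)) linearP.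
- by move=> z a u v; rewrite (linearPr (lact act)) linearP.
move=> i1 i2; apply/subr0_eq.
rewrite /uB /uM /= wordB_basis wordM_basis -gM -linearB.
exact/g_relator/relator_bm.
Qed.

Let proj_mb x y : uM x ** uB y = uM (ract act x y).
Proof.
apply: (linbasis_mul_ext (b := m) (b' := b)
  (c := fun x y => uM (ract act x y))).
- by move=> z a u v; rewrite (linearPl (ract act)) linearP.
- by move=> z a u v; rewrite (linearPr (ract act)) linearP.
move=> i1 i2; apply/subr0_eq.
rewrite /uB /uM /= wordB_basis wordM_basis -gM -linearB.
exact/g_relator/relator_mb.
Qed.

Let proj_mm x x' : uM x ** uM x' = 0.
Proof.
apply: (linbasis_mul_ext (b := m) (b' := m) (c := fun x x' => 0)).
- by move=> _ a u v; rewrite scaler0 addr0.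
- by move=> _ a u v; rewrite scaler0 addr0.
move=> i1 i2; rewrite /uM /= !wordM_basis -gM.
exact/g_relator/relator_mm.
Qed.

Let mulT t t' : t ** t' =
  i (lact act (p t) (j t') + ract act (j t) (p t') + f (p t) (p t'))
  + s (p t ** p t').
Proof.
rewrite -[in LHS](jpK t) -[in LHS](jpK t') numulDl !numulDr.
rewrite mul_ii mul_is mul_si mul_ss !linearD.
by rewrite add0r [s _ + _]addrC !addrA [i (ract _ _ _) + _]addrC.
Qed.

(** The map from [T] to [Q] through which [g] is to factor: it sends [i x + s y] to
    [uM x + uB y]. *)
Let rep t := uM (j t) + uB (p t).

Let rep_linear : linear rep.
Proof. by move=> a t t'; rewrite /rep !linearP scalerDr addrACA. Qed.

(** The images of [uM] and [uB] multiply in [Q] by the same table as those of [i] and [s] in [T]. *)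
Let repM : {morph rep : t t' / t ** t' >-> t ** t'}.
Proof.
move=> t t'; rewrite /rep numulDl !numulDr.
rewrite proj_mm proj_mb proj_bm proj_bb mulT.
rewrite !(linearD i) !(linearD j) !(linearD p).
rewrite !(iK _).1 !(iK _).2 !(sK _).1 !(sK _).2.
rewrite !add0r addr0 !linearD.
by rewrite [uB _ + uM _]addrC !addrA [uM (ract _ _ _) + _]addrC.
Qed.

Lemma kill_relators_factor : rep \o ev =1 g.
Proof.
pose rep' := HB.pack_for {linear T -> Q} rep
  (GRing.isLinear.Build k T Q *:%R rep rep_linear).
apply: (freenu_hom_ext (g := rep' \o ev)) => [y z|//|[j1|i1]] /=.
- by rewrite free_evalM repM.
- rewrite free_eval_gen -[LHS]/(rep _) /rep (iK _).1 (iK _).2 (linear0 uB).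
  by rewrite addr0 /uM /= wordM_basis.
- rewrite free_eval_gen -[LHS]/(rep _) /rep (sK _).1 (sK _).2 (linear0 uM).
  by rewrite add0r /uB /= wordB_basis.
Qed.

(** With the quotient projection as [g], this is the hard inclusion: the kernel of [ev] lies in the
    ideal of relations. *)
Lemma ker_ev_kill_relators x : ev x = 0 -> g x = 0.
Proof.
move=> evx; rewrite -kill_relators_factor /= evx.
by rewrite /rep (linear0 j) (linear0 p) (linear0 uM) (linear0 uB) addr0.
Qed.

End KillRelators.

Local Notation ideal := (nuideal_gen (relator act f b m)).

Lemma proj_relator r : relator act f b m r -> nuproj ideal r = 0.
Proof.
move=> rel; rewrite -(linear0 (nuproj ideal)); apply/nuproj_eq.
by rewrite subr0; apply/ideal_genP => ideal' /(_ r rel).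
Qed.

(** The map [ev] is onto by [jpK], and its kernel is the ideal of relations: one inclusion checks
    each relator in the table of [T], the other is [ker_ev_kill_relators]. *)
Lemma Ealg_nuiso : nuiso T (Ealg act f b m).
Proof.
apply: nuiso_sym; apply: (first_isomorphism (g := ev)) => [|t|x].
- exact: free_evalM.
- exists (wordM I m (j t) + wordB J b (p t)).
  by rewrite linearD /= ev_wordM ev_wordB jpK.
split=> [|/(ker_ev_kill_relators (@nuprojM _ _ ideal) proj_relator)].
  apply: (ideal_gen_sub_ker (@free_evalM _ _ _ letter_val)).
  move=> _ [i1 i2|i1 j1|j1 i1|j1 j2].
  - rewrite linearB /= linearD /= free_evalM ev_wordM ev_wordB !free_eval_gen.
    by rewrite mul_ss subrr.
  - by rewrite linearB /= free_evalM ev_wordM !free_eval_gen mul_si subrr.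
  - by rewrite linearB /= free_evalM ev_wordM !free_eval_gen mul_is subrr.
  - by rewrite /= free_evalM !free_eval_gen mul_ii.
by rewrite -(linear0 (nuproj ideal)) => /nuproj_eq; rewrite subr0.
Qed.

End PresentationOfExtension.

(** * The algebra on [M * B] defined by a cocycle *)

Section TwistedProduct.
Context (k : fieldType) (M B : nualgType k).
Context (act : bimodule B M) (f : {bilinear B -> B -> M}) (fc : cocycle act f).

(* The cocycle argument is what lets instance inference find associativity. *)
Definition twisted of cocycle act f : Type := (M * B)%type.
Local Notation T := (twisted fc).

HB.instance Definition _ := GRing.Lmodule.on T.

Definition twisted_mul (t t' : T) : T :=
  (lact act t.2 t'.1 + ract act t.1 t'.2 + f t.2 t'.2, t.2 ** t'.2).

(** In the [M] component the bimodule axioms match the terms free of [f]; the remaining equation is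
    the cocycle identity at [y], [y'], [y'']. *)
Lemma twisted_mulA : associative twisted_mul.
Proof.
move=> [x y] [x' y'] [x'' y'']; rewrite /twisted_mul /= numulA; congr (_, _).
rewrite !(linearDl (ract act)) !(linearDr (lact act)).
rewrite lactA ractA lractA -!addrA; do 2![congr (_ + _)].
rewrite addrCA; congr (_ + _); apply/eqP.
by rewrite -subr_eq addrAC -subr_eq0 fc.
Qed.

Lemma twisted_mul_bilinear : bilinear_for *:%R *:%R twisted_mul.
Proof.
split=> z a x y; congr (_, _) => /=; rewrite ?scalerDr.
- rewrite (linearPl (lact act)) (linearPl f) (linearPl (ract act)).
  by rewrite [X in X + _]addrACA [LHS]addrACA.
- by rewrite numulDl nuscalel.
- rewrite (linearPr (lact act)) (linearPr f) (linearPr (ract act)).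
  by rewrite [X in X + _]addrACA [LHS]addrACA.
- by rewrite numulDr nuscaler.
Qed.

HB.instance Definition _ := Lmodule_isNuAlgebra.Build k T twisted_mulA
  twisted_mul_bilinear.

Definition twisted_inl (x : M) : T := (x, 0).
Definition twisted_inr (y : B) : T := (0, y).
Definition twisted_fst (t : T) : M := t.1.
Definition twisted_snd (t : T) : B := t.2.

Lemma twisted_inl_is_linear : linear twisted_inl.
Proof. by move=> a x y; congr (_, _); rewrite /= scaler0 addr0. Qed.

Lemma twisted_inr_is_linear : linear twisted_inr.
Proof. by move=> a x y; congr (_, _); rewrite /= scaler0 addr0. Qed.

Lemma twisted_fst_is_linear : linear twisted_fst.
Proof. by []. Qed.

Lemma twisted_snd_is_linear : linear twisted_snd.
Proof. by []. Qed.

HB.instance Definition _ := GRing.isLinear.Build k M T *:%R twisted_inl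
  twisted_inl_is_linear.
HB.instance Definition _ := GRing.isLinear.Build k B T *:%R twisted_inr
  twisted_inr_is_linear.
HB.instance Definition _ := GRing.isLinear.Build k T M *:%R twisted_fst
  twisted_fst_is_linear.
HB.instance Definition _ := GRing.isLinear.Build k T B *:%R twisted_snd
  twisted_snd_is_linear.

Lemma twisted_nuiso (I J : choiceType) (b : linbasis B I) (m : linbasis M J) :
  nuiso T (Ealg act f b m).
Proof.
apply: (@Ealg_nuiso _ _ _ _ _ _ _ _ _ _ twisted_inl twisted_inr
  twisted_fst twisted_snd) => //.
- by move=> [x y]; congr (_, _); rewrite /= ?addr0 ?add0r.
- by move=> y y'; congr (_, _); rewrite /= ?linear0r ?linear0l ?addr0 ?add0r.
- by move=> y x; congr (_, _); rewrite /= ?linear0r ?linear0l ?addr0 ?add0r.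
- by move=> x y; congr (_, _); rewrite /= ?linear0r ?linear0l ?addr0 ?add0r.
- by move=> x x'; congr (_, _); rewrite /= ?linear0r ?linear0l ?addr0 ?add0r.
Qed.

End TwistedProduct.

(** * Extensions as short exact sequences *)

Section Extensions.
Context (k : fieldType) (M B R : nualgType k).
Hypothesis M2_eq0 : forall x y : M, x ** y = 0.

(** The ideal is the kernel of [p], and the first isomorphism theorem identifies the quotient with
    [B]. *)
Lemma extension_of_exact (i : M -> R) (p : {linear R -> B}) :
  nuhom i -> injective i -> {morph p : r r' / r ** r' >-> r ** r'} ->
  (forall y, exists r, p r = y) -> (forall r, p r = 0 <-> exists x, i x = r) ->
  extension M B R.
Proof.
move=> i_hom i_inj pM p_surj ker_p; split=> //; exists i => //.
exists (nuker pM) => [r|].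
  by rewrite nukerE -ker_p; split=> [/eqP|/eqP].
by apply: first_isomorphism p_surj _ => // r; rewrite nukerE; split=> /eqP.
Qed.

(** The inclusion of [M] and the projection onto [B] are transported to [R] along the
    isomorphism. *)
Lemma twisted_extension (act : bimodule B M) (f : {bilinear B -> B -> M})
  (fc : cocycle act f) : nuiso R (twisted fc) -> extension M B R.
Proof.
move=> [g [[g_lin gM] [h gK hK]]].
have h_hom : nuhom h.
  split=> [a x y|x y]; apply: (can_inj gK); rewrite hK.
    by rewrite g_lin !hK.
  by rewrite gM !hK.
pose p r : B := twisted_snd (g r).
have p_lin : linear p by move=> a x y; rewrite /p g_lin linearP.
pose P := HB.pack_for {linear R -> B} p
  (GRing.isLinear.Build k R B *:%R p p_lin).
apply: (@extension_of_exact (h \o twisted_inl fc) P).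
(* Elements with zero [B] component have product 0 in the twisted product, in agreement with
   [M2_eq0]. *)
- split=> [a x y|x y] /=; first by rewrite linearP h_hom.1.
  rewrite -h_hom.2; congr h; rewrite M2_eq0; congr (_, _) => /=.
    by rewrite !linear0r !linear0l !addr0.
  by rewrite linear0r.
- by apply: inj_comp; [exact: can_inj hK|move=> x y []].
- by move=> r r'; rewrite /= /p gM.
- by move=> y; exists (h (twisted_inr fc y)); rewrite /= /p hK.
move=> r; rewrite /= /p; split=> [gr0|[x <-]]; last by rewrite hK.
exists (twisted_fst (g r)); rewrite -[RHS]gK; congr h.
by case: (g r) gr0 => x y /= ->.
Qed.

(** Here [p] is the quotient projection followed by the isomorphism onto [B], so its kernel is the
    ideal, which is the image of [i]. *)
Lemma extension_exact : extension M B R -> exists (i : {linear M -> R})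
    (p : {linear R -> B}),
  [/\ {morph i : x y / x ** y >-> x ** y}, injective i,
      {morph p : r r' / r ** r' >-> r ** r'}, forall y, exists r, p r = y &
      forall r, p r = 0 <-> exists x, i x = r].
Proof.
move=> [_ [i [[i_lin iM] i_inj] [I I_i [g [[g_lin gM] [h gK hK]]]]]].
pose i' := HB.pack_for {linear M -> R} i
  (GRing.isLinear.Build k M R *:%R i i_lin).
pose g' := HB.pack_for {linear nuquot I -> B} g
  (GRing.isLinear.Build k (nuquot I) B *:%R g g_lin).
exists i', (g' \o nuproj I); split=> //.
- by move=> r r' /=; rewrite nuprojM gM.
- by move=> y; exists (repr (h y)); rewrite /= nuproj_surj hK.
move=> r; rewrite -I_i -[r in r \in I]subr0 -nuproj_eq linear0 /=.
have g0 : g 0 = 0 := linear0 g'.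
by split=> [gr0|->//]; apply: (can_inj gK); rewrite gr0 g0.
Qed.

End Extensions.

(** * Bimodule and factor set read off from a linear section *)

Section FactorSet.
Context (k : fieldType) (M B R : nualgType k).
Hypothesis M2_eq0 : forall x y : M, x ** y = 0.
Context (i : {linear M -> R}) (p : {linear R -> B}).
Hypothesis (iM : {morph i : x y / x ** y >-> x ** y}) (i_inj : injective i).
Hypothesis (pM : {morph p : r r' / r ** r' >-> r ** r'}).
Hypothesis (ker_p : forall r, p r = 0 <-> exists x, i x = r).
Context (s : {linear B -> R}) (sK : cancel s p).

Let pi0 x : p (i x) = 0.
Proof. by apply/ker_p; exists x. Qed.

(** The element [r - s (p r)] is killed by [p], so it comes from a unique element of [M];
    injectivity of [i] makes this choice linear. *)
Let exists_retraction :
  exists j : {linear R -> M}, forall r, i (j r) = r - s (p r).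
Proof.
have /choice[j jE] r : exists x, i x = r - s (p r).
  by apply/ker_p; rewrite linearB sK subrr.
have j_lin : linear j.
  move=> a r r'; apply: i_inj; rewrite linearP !jE (linearP p) (linearP s).
  by rewrite scalerBr opprD addrACA.
by exists (HB.pack_for {linear R -> M} j
  (GRing.isLinear.Build k R M *:%R j j_lin)).
Qed.

Let j : {linear R -> M} := projT1 (cid exists_retraction).

Let jE r : i (j r) = r - s (p r).
Proof. exact: projT2 (cid exists_retraction) r. Qed.

(** In the two actions [j] merely inverts [i], the products lying in the ideal. In [ext_factor] it
    extracts the failure of [s] to be multiplicative. *)
Definition ext_lact y x := j (s y ** i x).
Definition ext_ract x y := j (i x ** s y).
Definition ext_factor y y' := j (s y ** s y').

Lemma ext_lact_bilinear : bilinear_for *:%R *:%R ext_lact.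
Proof.
split=> z a x y; rewrite /ext_lact linearP.
  by rewrite numulDl nuscalel linearP.
by rewrite numulDr nuscaler linearP.
Qed.

Lemma ext_ract_bilinear : bilinear_for *:%R *:%R ext_ract.
Proof.
split=> z a x y; rewrite /ext_ract linearP.
  by rewrite numulDl nuscalel linearP.
by rewrite numulDr nuscaler linearP.
Qed.

Lemma ext_factor_bilinear : bilinear_for *:%R *:%R ext_factor.
Proof.
split=> z a x y; rewrite /ext_factor linearP.
  by rewrite numulDl nuscalel linearP.
by rewrite numulDr nuscaler linearP.
Qed.

HB.instance Definition _ := bilinear_isBilinear.Build k B M M *:%R *:%R ext_lact
  ext_lact_bilinear.
HB.instance Definition _ := bilinear_isBilinear.Build k M B M *:%R *:%R ext_ract
  ext_ract_bilinear.
HB.instance Definition _ := bilinear_isBilinear.Build k B B M *:%R *:%R ext_factor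
  ext_factor_bilinear.

Lemma ext_lactE y x : i (ext_lact y x) = s y ** i x.
Proof. by rewrite jE pM pi0 linear0r linear0 subr0. Qed.

Lemma ext_ractE x y : i (ext_ract x y) = i x ** s y.
Proof. by rewrite jE pM pi0 linear0l linear0 subr0. Qed.

Lemma ext_factorE y y' : i (ext_factor y y') = s y ** s y' - s (y ** y').
Proof. by rewrite jE pM !sK. Qed.

Let mul_ii x x' : i x ** i x' = 0.
Proof. by rewrite -iM M2_eq0 linear0. Qed.

Lemma section_mulE y y' : s (y ** y') = s y ** s y' - i (ext_factor y y').
Proof. by rewrite ext_factorE subKr. Qed.

(** The section is multiplicative up to an element of [i M], which annihilates [i x] since [M] has
    square zero. *)
Lemma ext_lactA y y' x : ext_lact (y ** y') x = ext_lact y (ext_lact y' x).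
Proof.
by apply: i_inj; rewrite !ext_lactE section_mulE numulBl mul_ii subr0 numulA.
Qed.

Lemma ext_ractA x y y' : ext_ract x (y ** y') = ext_ract (ext_ract x y) y'.
Proof.
by apply: i_inj; rewrite !ext_ractE section_mulE numulBr mul_ii subr0 numulA.
Qed.

Lemma ext_lractA y x y' :
  ext_ract (ext_lact y x) y' = ext_lact y (ext_ract x y').
Proof. by apply: i_inj; rewrite ext_ractE ext_lactE ext_lactE ext_ractE numulA. Qed.

Definition ext_bimodule : bimodule B M :=
  @Bimodule k B M ext_lact ext_ract ext_lactA ext_ractA ext_lractA.

(** After applying [i] and expanding by associativity in [R], all terms cancel in pairs. *)
Lemma ext_cocycle : cocycle ext_bimodule ext_factor.
Proof.
move=> y y' y''; apply: i_inj; rewrite linear0 !(linearB, linearD) /=.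
rewrite ext_lactE ext_ractE !ext_factorE numulBr numulBl !numulA.
by rewrite [X in X - _]addrAC subrKA opprB subrKA subrr.
Qed.

Lemma ext_nuiso (I J : choiceType) (b : linbasis B I) (m : linbasis M J) :
  nuiso R (Ealg ext_bimodule ext_factor b m).
Proof.
apply: (@Ealg_nuiso _ _ _ _ _ _ _ _ _ _ i s j p) => /=.
- by move=> x; split=> //; apply: i_inj; rewrite jE pi0 linear0 subr0.
- by move=> y; split=> //; apply: i_inj; rewrite jE sK subrr linear0.
- by move=> r; rewrite jE subrK.
- by move=> y y'; rewrite ext_factorE subrKC.
- by move=> y x; rewrite ext_lactE.
- by move=> x y; rewrite ext_ractE.
- exact: mul_ii.
Qed.

End FactorSet.

Theorem theorem2p3 (k : fieldType) (M B R : nualgType k)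
    (M2_eq0 : forall x y : M, x ** y = 0) :
  (extension M B R ->
     exists (act : bimodule B M) (f : {bilinear B -> B -> M}),
       cocycle act f /\
       forall (dI dJ : Order.disp_t) (I : orderType dI) (J : orderType dJ)
              (b : linbasis B I) (m : linbasis M J),
         nuiso R (Ealg act f b m)) /\
  (forall (dI dJ : Order.disp_t) (I : orderType dI) (J : orderType dJ)
          (b : linbasis B I) (m : linbasis M J),
     (exists (act : bimodule B M) (f : {bilinear B -> B -> M}),
        cocycle act f /\ nuiso R (Ealg act f b m)) ->
     extension M B R).
Proof.
split=> [/extension_exact[i [p [iM i_inj pM p_surj ker_p]]]|].
  have [s sK] := linear_section p_surj.
  (* The actions and the factor set come from the section alone, so they are fixed before any bases
     are given. *)
  exists (ext_bimodule M2_eq0 iM i_inj pM ker_p sK).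
  exists (ext_factor i_inj ker_p sK).
  by split=> [|dI dJ I J b m]; [exact: ext_cocycle|exact: ext_nuiso].
move=> dI dJ I J b m [act [f [fc R_E]]].
(* On the given bases the presented algebra is isomorphic to the twisted product of [f], which is
   known to be an extension. *)
apply: (twisted_extension M2_eq0 (fc := fc)).
exact: nuiso_trans R_E (nuiso_sym (twisted_nuiso _ _ _)).
Qed.
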